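(* Let $k$ be a field of characteristic $0$ and let $\mathrm{DerPerm}\langle X\rangle$ be the free differential perm algebra on $X$ over $k$, with the product $a\diamond b:=ab'+ba'$. Put $\langle a,b,c\rangle:=(a\diamond b)\diamond c-a\diamond(b\diamond c)$. Then the algebra $(\mathrm{DerPerm}\langle X\rangle,\diamond)$ is commutative and satisfies, for all elements $a,b,c,d,e$, the Tortken identity $$(a\diamond b)\diamond (c\diamond d)-(a\diamond d)\diamond (b\diamond c)+\langle a,b,c\rangle\diamond d-\langle a,d,c\rangle\diamond b=0,$$ as well as the following identity of degree $5$: $$\begin{aligned} & 2((((b\diamond a)\diamond c)\diamond d)\diamond e)-((((b\diamond a)\diamond c)\diamond e)\diamond d)\\ &-2((((b\diamond a)\diamond d)\diamond c)\diamond e)+((((b\diamond a)\diamond d)\diamond e)\diamond c)\\ &-((((c\diamond a)\diamond b)\diamond d)\diamond e)+((((c\diamond a)\diamond b)\diamond e)\diamond d)\\ &+((((c\diamond a)\diamond d)\diamond e)\diamond b)-((((c\diamond a)\diamond e)\diamond b)\diamond d)\\ &+((((d\diamond a)\diamond b)\diamond c)\diamond e)-((((d\diamond a)\diamond b)\diamond e)\diamond c)\\ &-((((d\diamond a)\diamond c)\diamond e)\diamond b)+((((d\diamond a)\diamond e)\diamond b)\diamond c)\\ &+((((e\diamond a)\diamond b)\diamond c)\diamond d)-((((e\diamond a)\diamond b)\diamond d)\diamond c)=0. \end{aligned}$$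
   Context: A perm algebra is an associative algebra satisfying $(ab)c=(ba)c$. A differential perm algebra is a perm algebra equipped with a derivation; here the derivation of an element $a$ is written $a'$ (the letter $d$ in the identities denotes an arbitrary element, not the derivation). The free differential perm algebra $\mathrm{DerPerm}\langle X\rangle$ on $X=\{x_1,x_2,\dots\}$ is the free perm algebra generated by the symbols $x^{(s)}$ ($x\in X$, $s\ge 0$, $x^{(0)}=x$) with the derivation determined by $(x^{(s)})'=x^{(s+1)}$ and the Leibniz rule. *)

(* Defs.v *)
From HB Require Import structures.
From mathcomp Require Import all_boot all_algebra.
From mathcomp Require Import boolp.

Set Implicit Arguments.
Unset Strict Implicit.
Unset Printing Implicit Defensive.

Import GRing.Theory.
Local Open Scope ring_scope.
Local Open Scope quotient_scope.

(* Perm algebras have no unit, so they cannot be built on MathComp's rings. *)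
HB.mixin Record Lmodule_isPermAlgebra (k : fieldType) A of GRing.Lmodule k A := {
  pmul : A -> A -> A;
  pmulDl : forall a b c, pmul (a + b) c = pmul a c + pmul b c;
  pmulDr : forall a b c, pmul a (b + c) = pmul a b + pmul a c;
  pmulZl : forall (l : k) a b, pmul (l *: a) b = l *: pmul a b;
  pmulZr : forall (l : k) a b, pmul a (l *: b) = l *: pmul a b;
  pmulA : forall a b c, pmul a (pmul b c) = pmul (pmul a b) c;
  pmul_perm : forall a b c, pmul (pmul a b) c = pmul (pmul b a) c
}.

#[short(type="permAlgType")]
HB.structure Definition PermAlgebra (k : fieldType) :=
  {A of Lmodule_isPermAlgebra k A & GRing.Lmodule k A}.

HB.mixin Record PermAlgebra_isDifferential (k : fieldType) A
    of PermAlgebra k A := {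
  pder : A -> A;
  pderD : forall a b, pder (a + b) = pder a + pder b;
  pderZ : forall (l : k) a, pder (l *: a) = l *: pder a;
  pder_leibniz : forall a b, pder (pmul a b) = pmul (pder a) b + pmul a (pder b)
}.

#[short(type="diffPermAlgType")]
HB.structure Definition DiffPermAlgebra (k : fieldType) :=
  {A of PermAlgebra_isDifferential k A & PermAlgebra k A}.

(* The free perm algebra on Y is presented as formal expressions over Y modulo
   the least congruence forced by the axioms; its universal property is
   [freePerm_lift] and [freePerm_ext]. *)
Inductive pterm (k Y : Type) : Type :=
| PGen of Y
| PZero
| PAdd of pterm k Y & pterm k Y
| PScale of k & pterm k Y
| PMul of pterm k Y & pterm k Y.
Arguments PGen {k Y}.
Arguments PZero {k Y}.

Inductive peq (k : fieldType) (Y : Type) : pterm k Y -> pterm k Y -> Prop :=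
| peq_refl t : peq t t
| peq_sym t u : peq t u -> peq u t
| peq_trans t u v : peq t u -> peq u v -> peq t v
| peq_add t t' u u' : peq t t' -> peq u u' -> peq (PAdd t u) (PAdd t' u')
| peq_scale l t t' : peq t t' -> peq (PScale l t) (PScale l t')
| peq_mul t t' u u' : peq t t' -> peq u u' -> peq (PMul t u) (PMul t' u')
| peq_addA t u v : peq (PAdd t (PAdd u v)) (PAdd (PAdd t u) v)
| peq_addC t u : peq (PAdd t u) (PAdd u t)
| peq_add0 t : peq (PAdd PZero t) t
| peq_addN t : peq (PAdd (PScale (-1) t) t) PZero
| peq_scaleA l m t : peq (PScale l (PScale m t)) (PScale (l * m) t)
| peq_scale1 t : peq (PScale 1 t) t
| peq_scaleDr l t u : peq (PScale l (PAdd t u)) (PAdd (PScale l t) (PScale l u))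
| peq_scaleDl l m t : peq (PScale (l + m) t) (PAdd (PScale l t) (PScale m t))
| peq_mulDl t u v : peq (PMul (PAdd t u) v) (PAdd (PMul t v) (PMul u v))
| peq_mulDr t u v : peq (PMul t (PAdd u v)) (PAdd (PMul t u) (PMul t v))
| peq_mulZl l t u : peq (PMul (PScale l t) u) (PScale l (PMul t u))
| peq_mulZr l t u : peq (PMul t (PScale l u)) (PScale l (PMul t u))
| peq_mulA t u v : peq (PMul t (PMul u v)) (PMul (PMul t u) v)
| peq_perm t u v : peq (PMul (PMul t u) v) (PMul (PMul u t) v).

HB.instance Definition _ (k Y : Type) := gen_eqMixin (pterm k Y).
HB.instance Definition _ (k Y : Type) := gen_choiceMixin (pterm k Y).

Section FreePerm.
Variables (k : fieldType) (Y : Type).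
Local Notation T := (pterm k Y).

Definition peqb : rel T := fun t u => `[< peq t u >].

Lemma peqb_refl : reflexive peqb.
Proof. by move=> t; apply/asboolP; exact: peq_refl. Qed.

Lemma peqb_sym : symmetric peqb.
Proof. by move=> t u; apply/asboolP/asboolP; exact: peq_sym. Qed.

Lemma peqb_trans : transitive peqb.
Proof.
by move=> t u v /asboolP ut /asboolP tv; apply/asboolP; exact: peq_trans tv.
Qed.

Canonical peqb_equiv := EquivRel peqb peqb_refl peqb_sym peqb_trans.

Definition freePerm : Type := {eq_quot peqb}.
HB.instance Definition _ := Choice.on freePerm.
HB.instance Definition _ := Quotient.on freePerm.

Local Notation cl t := (\pi_freePerm t).

Lemma clP (t u : T) : cl t = cl u <-> peq t u.
Proof.
split; first by move/eqmodP => /asboolP.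
by move=> tu; apply/eqmodP/asboolP.
Qed.

Definition fgen (y : Y) : freePerm := cl (PGen y).
Definition fzero : freePerm := cl PZero.
Definition fadd (a b : freePerm) : freePerm := cl (PAdd (repr a) (repr b)).
Definition fscale (l : k) (a : freePerm) : freePerm := cl (PScale l (repr a)).
Definition fopp (a : freePerm) : freePerm := fscale (-1) a.
Definition fmul (a b : freePerm) : freePerm := cl (PMul (repr a) (repr b)).

Lemma repr_cl t : peq (repr (cl t)) t.
Proof. by apply/clP; rewrite reprK. Qed.

Lemma fadd_cl t u : fadd (cl t) (cl u) = cl (PAdd t u).
Proof. by apply/clP/peq_add; exact: repr_cl. Qed.

Lemma fscale_cl l t : fscale l (cl t) = cl (PScale l t).
Proof. by apply/clP/peq_scale; exact: repr_cl. Qed.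

Lemma fmul_cl t u : fmul (cl t) (cl u) = cl (PMul t u).
Proof. by apply/clP/peq_mul; exact: repr_cl. Qed.

Definition fE := (fadd_cl, fscale_cl, fmul_cl).

Lemma clW (P : freePerm -> Prop) : (forall t, P (cl t)) -> forall a, P a.
Proof. by move=> Pt a; rewrite -[a]reprK. Qed.

Lemma faddA : associative fadd.
Proof. by do 3!elim/clW=> ?; rewrite !fE; apply/clP/peq_addA. Qed.

Lemma faddC : commutative fadd.
Proof. by do 2!elim/clW=> ?; rewrite !fE; apply/clP/peq_addC. Qed.

Lemma fadd0 : left_id fzero fadd.
Proof. by elim/clW=> ?; rewrite !fE; apply/clP/peq_add0. Qed.

Lemma faddN : left_inverse fzero fopp fadd.
Proof. by elim/clW=> ?; rewrite /fopp !fE; apply/clP/peq_addN. Qed.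

HB.instance Definition _ :=
  GRing.isZmodule.Build freePerm faddA faddC fadd0 faddN.

Lemma faddE (a b : freePerm) : a + b = fadd a b. Proof. by []. Qed.

Lemma fscaleA l m a : fscale l (fscale m a) = fscale (l * m) a.
Proof. by elim/clW: a => ?; rewrite !fE; apply/clP/peq_scaleA. Qed.

Lemma fscale1 : left_id 1 fscale.
Proof. by elim/clW=> ?; rewrite !fE; apply/clP/peq_scale1. Qed.

Lemma fscaleDr : right_distributive fscale +%R.
Proof. by move=> ?; do 2!elim/clW=> ?; rewrite !faddE !fE; apply/clP/peq_scaleDr. Qed.

Lemma fscaleDl a : {morph fscale^~ a : l m / l + m}.
Proof. by elim/clW: a => ? ? ?; rewrite faddE !fE; apply/clP/peq_scaleDl. Qed.

HB.instance Definition _ :=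
  GRing.Zmodule_isLmodule.Build k freePerm fscaleA fscale1 fscaleDr fscaleDl.

Lemma fscaleE (l : k) (a : freePerm) : l *: a = fscale l a. Proof. by []. Qed.

Lemma fmulDl (a b c : freePerm) : fmul (a + b) c = fmul a c + fmul b c.
Proof.
by elim/clW: a => ?; elim/clW: b => ?; elim/clW: c => ?; rewrite !faddE !fE; apply/clP/peq_mulDl.
Qed.

Lemma fmulDr (a b c : freePerm) : fmul a (b + c) = fmul a b + fmul a c.
Proof.
by elim/clW: a => ?; elim/clW: b => ?; elim/clW: c => ?; rewrite !faddE !fE; apply/clP/peq_mulDr.
Qed.

Lemma fmulZl (l : k) (a b : freePerm) : fmul (l *: a) b = l *: fmul a b.
Proof.
by elim/clW: a => ?; elim/clW: b => ?; rewrite !fscaleE !fE; apply/clP/peq_mulZl.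
Qed.

Lemma fmulZr (l : k) (a b : freePerm) : fmul a (l *: b) = l *: fmul a b.
Proof.
by elim/clW: a => ?; elim/clW: b => ?; rewrite !fscaleE !fE; apply/clP/peq_mulZr.
Qed.

Lemma fmulA (a b c : freePerm) : fmul a (fmul b c) = fmul (fmul a b) c.
Proof.
by elim/clW: a => ?; elim/clW: b => ?; elim/clW: c => ?; rewrite !fE; apply/clP/peq_mulA.
Qed.

Lemma fmul_perm (a b c : freePerm) : fmul (fmul a b) c = fmul (fmul b a) c.
Proof.
by elim/clW: a => ?; elim/clW: b => ?; elim/clW: c => ?; rewrite !fE; apply/clP/peq_perm.
Qed.

HB.instance Definition _ := Lmodule_isPermAlgebra.Build k freePerm
  fmulDl fmulDr fmulZl fmulZr fmulA fmul_perm.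

Lemma freePerm_ind (P : freePerm -> Prop) :
  (forall y, P (fgen y)) -> P 0 -> (forall a b, P a -> P b -> P (a + b)) ->
  (forall (l : k) a, P a -> P (l *: a)) ->
  (forall a b, P a -> P b -> P (pmul a b)) -> forall a, P a.
Proof.
move=> Pg P0 PD PZ PM; elim/clW; elim=> [y||t Pt u Pu|l t Pt|t Pt u Pu].
- exact: Pg.
- exact: P0.
- by have := PD _ _ Pt Pu; rewrite faddE fadd_cl.
- by have := PZ l _ Pt; rewrite fscaleE fscale_cl.
- by have := PM _ _ Pt Pu; rewrite [pmul _ _]fmul_cl.
Qed.

Lemma freePerm_lift (B : permAlgType k) (g : Y -> B) :
  exists f : {linear freePerm -> B},
    (forall a b, f (pmul a b) = pmul (f a) (f b)) /\ forall y, f (fgen y) = g y.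
Proof.
pose fix ev (t : T) : B := match t with
  | PGen y => g y
  | PZero => 0
  | PAdd t u => ev t + ev u
  | PScale l t => l *: ev t
  | PMul t u => pmul (ev t) (ev u)
  end.
have evP t u : peq t u -> ev t = ev u.
  elim=> {t u} //=.
  - by move=> t u v _ -> _ ->.
  - by move=> t t' u u' _ -> _ ->.
  - by move=> l t t' _ ->.
  - by move=> t t' u u' _ -> _ ->.
  - by move=> *; exact: addrA.
  - by move=> *; exact: addrC.
  - by move=> *; exact: add0r.
  - by move=> *; rewrite scaleN1r addNr.
  - by move=> *; exact: scalerA.
  - by move=> *; exact: scale1r.
  - by move=> *; exact: scalerDr.
  - by move=> *; exact: scalerDl.
  - by move=> *; exact: pmulDl.
  - by move=> *; exact: pmulDr.
  - by move=> *; exact: pmulZl.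
  - by move=> *; exact: pmulZr.
  - by move=> *; exact: pmulA.
  - by move=> *; exact: pmul_perm.
pose f (a : freePerm) := ev (repr a).
have fcl t : f (cl t) = ev t by apply/evP/repr_cl.
have lf : linear f.
  move=> l; elim/clW=> t; elim/clW=> u.
  by rewrite fscaleE fscale_cl faddE fadd_cl !fcl.
pose F := GRing.isLinear.Build k freePerm B _ f lf.
pose h : {linear freePerm -> B} := HB.pack f F.
exists h; split=> [a b|y]; last exact: fcl.
elim/clW: a => t; elim/clW: b => u.
by rewrite [pmul (cl t) _]fmul_cl /= !fcl.
Qed.

Lemma freePerm_ext (B : permAlgType k) (f g : {linear freePerm -> B}) :
  (forall a b, f (pmul a b) = pmul (f a) (f b)) ->
  (forall a b, g (pmul a b) = pmul (g a) (g b)) ->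
  (forall y, f (fgen y) = g (fgen y)) -> f =1 g.
Proof.
move=> fM gM fg; elim/freePerm_ind => [//||a b ea eb|l a ea|a b ea eb].
- by rewrite !linear0.
- by rewrite !linearD ea eb.
- by rewrite !linearZ ea.
- by rewrite fM gM ea eb.
Qed.

End FreePerm.

Section DerPerm.
Variables (k : fieldType) (X : Type).

(* The free perm algebra on the symbols x^(s), encoded as pairs (x, s).  Its
   derivation [dder] is forced by [pder_dgen], and [DerPerm_lift] and
   [DerPerm_ext] give freeness among differential perm algebras. *)
Definition DerPerm : Type := freePerm k (X * nat).
HB.instance Definition _ := PermAlgebra.on DerPerm.

Definition dgen (x : X) (s : nat) : DerPerm := fgen k (x, s).

Fixpoint tder (t : pterm k (X * nat)) : pterm k (X * nat) :=
  match t with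
  | PGen (x, s) => PGen (x, s.+1)
  | PZero => PZero
  | PAdd t u => PAdd (tder t) (tder u)
  | PScale l t => PScale l (tder t)
  | PMul t u => PAdd (PMul (tder t) u) (PMul t (tder u))
  end.

Local Notation cl t := (\pi_(freePerm k (X * nat)) t).

Let clD (t u : pterm k (X * nat)) : cl (PAdd t u) = cl t + cl u.
Proof. by rewrite -fadd_cl. Qed.
Let clZ (l : k) (t : pterm k (X * nat)) : cl (PScale l t) = l *: cl t.
Proof. by rewrite -fscale_cl. Qed.
Let clM (t u : pterm k (X * nat)) : cl (PMul t u) = pmul (cl t) (cl u).
Proof. by rewrite -fmul_cl. Qed.
Let cl0 : cl PZero = 0. Proof. by []. Qed.

Lemma tder_peq t u : peq t u -> cl (tder t) = cl (tder u).
Proof.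
elim=> {t u} //=; try by move=> *; rewrite !(clD, clZ, clM, cl0);
  rewrite ?addrA ?add0r ?scaleN1r ?addNr ?scalerA ?scale1r ?scalerDr ?scalerDl.
- by move=> t u v _ -> _ ->.
- by move=> t t' u u' _ e _ f; rewrite !clD e f.
- by move=> l t t' _ e; rewrite !clZ e.
- move=> t t' u u' /clP e e' /clP f f'.
  by rewrite !clD !clM e e' f f'.
- by move=> t u; rewrite !clD addrC.
- by move=> t u v; rewrite !(clD, clM) !pmulDl addrACA.
- by move=> t u v; rewrite !(clD, clM) !pmulDr addrACA.
- by move=> l t u; rewrite !(clD, clZ, clM) !pmulZl -scalerDr.
- by move=> l t u; rewrite !(clD, clZ, clM) !pmulZr -scalerDr.
- by move=> t u v; rewrite !(clD, clM) !(pmulDl, pmulDr) !pmulA addrA.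
- move=> t u v; rewrite !(clD, clM) !pmulDl.
  rewrite (pmul_perm (cl (tder t)) (cl u)) (pmul_perm (cl t) (cl (tder u))).
  by rewrite (pmul_perm (cl t) (cl u)) [X in X + _]addrC.
Qed.

Definition dder (a : DerPerm) : DerPerm := cl (tder (repr a)).

Lemma dder_cl t : dder (cl t) = cl (tder t).
Proof. by apply/tder_peq/repr_cl. Qed.

Lemma dderD (a b : DerPerm) : dder (a + b) = dder a + dder b.
Proof.
by elim/clW: a => t; elim/clW: b => u; rewrite -clD !dder_cl -clD.
Qed.

Lemma dderZ (l : k) (a : DerPerm) : dder (l *: a) = l *: dder a.
Proof. by elim/clW: a => t; rewrite -clZ !dder_cl -clZ. Qed.

Lemma dder_leibniz (a b : DerPerm) :
  dder (pmul a b) = pmul (dder a) b + pmul a (dder b).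
Proof.
by elim/clW: a => t; elim/clW: b => u; rewrite -clM !dder_cl -!clM -clD.
Qed.

HB.instance Definition _ := PermAlgebra_isDifferential.Build k DerPerm
  dderD dderZ dder_leibniz.

Lemma pder_dgen x s : pder (dgen x s) = dgen x s.+1.
Proof. exact: dder_cl. Qed.

Lemma DerPerm_lift (B : diffPermAlgType k) (g : X -> B) :
  exists f : {linear DerPerm -> B},
    [/\ forall a b, f (pmul a b) = pmul (f a) (f b),
        forall a, f (pder a) = pder (f a) & forall x, f (dgen x 0) = g x].
Proof.
have [f [fM fg]] := freePerm_lift (fun y : X * nat => iter y.2 (@pder k B) (g y.1)).
have p0 (C : diffPermAlgType k) : pder (0 : C) = 0.
  by have := pderZ 0 (0 : C); rewrite !scale0r.
exists f; split=> // [a|x]; last exact: fg.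
elim/(@freePerm_ind k (X * nat)%type): a => [[x s]||a b ea eb|l a ea|a b ea eb].
- rewrite [fgen k _]/(dgen x s) pder_dgen.
  by rewrite [f (dgen x s.+1)]fg [f (dgen x s)]fg.
- by rewrite (p0 DerPerm) linear0 p0.
- by rewrite (pderD (a : DerPerm) b) !linearD pderD ea eb.
- by rewrite (pderZ l (a : DerPerm)) !linearZ pderZ ea.
- rewrite (pder_leibniz (a : DerPerm) b) linearD.
  by rewrite [X in X + _]fM [X in _ + X]fM [f (pmul a b)]fM pder_leibniz ea eb.
Qed.

Lemma DerPerm_ext (B : diffPermAlgType k) (f g : {linear DerPerm -> B}) :
  (forall a b, f (pmul a b) = pmul (f a) (f b)) ->
  (forall a b, g (pmul a b) = pmul (g a) (g b)) ->
  (forall a, f (pder a) = pder (f a)) -> (forall a, g (pder a) = pder (g a)) ->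
  (forall x, f (dgen x 0) = g (dgen x 0)) -> f =1 g.
Proof.
move=> fM gM fd gd fg; apply: (freePerm_ext fM gM) => -[x s].
rewrite -[fgen k _]/(dgen x s).
by elim: s => [|s IH]; [exact: fg | rewrite -pder_dgen fd gd IH].
Qed.

End DerPerm.

Definition diamond (k : fieldType) (A : diffPermAlgType k) (a b : A) : A :=
  pmul a (pder b) + pmul b (pder a).

Declare Scope diamond_scope.
Delimit Scope diamond_scope with diamond.
Notation "a ⋄ b" := (diamond a b) (at level 40, left associativity) : diamond_scope.

Definition diamond_assoc (k : fieldType) (A : diffPermAlgType k) (a b c : A) : A :=
  ((a ⋄ b) ⋄ c - a ⋄ (b ⋄ c))%diamond.
Notation "⟨ a , b , c ⟩" := (diamond_assoc a b c)
  (at level 0, a, b, c at level 99) : diamond_scope.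

(* Main.v *)
Require Import Defs.
From mathcomp Require Import all_boot all_algebra.

(** In a perm algebra all letters of a word except the last one commute, so a
    differential monomial is a multiset of letters x^(s) together with a last
    letter.  Expanding the left-hand side of each identity into an integer
    combination of such monomials and collecting equal ones, everything cancels;
    this finite computation is valid in every differential perm algebra. *)

Import GRing.Theory.
Local Open Scope ring_scope.
Local Open Scope diamond_scope.

(* The letter [(i, s)] stands for the [s]-th derivative of the [i]-th variable. *)
Local Notation letter := (nat * nat)%type.
Local Notation monomial := (seq letter * letter)%type.
Local Notation dpoly := (seq (int * monomial)).

(** * Formal differential expressions and their expansion into monomials *)

Inductive dexpr :=
| DVar of nat
| DAdd of dexpr & dexpr
| DOpp of dexpr
| DScale of int & dexpr
| DMul of dexpr & dexpr
| DDer of dexpr.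

Definition letter_der (x : letter) : letter := (x.1, x.2.+1).

Fixpoint monomial_der (p : seq letter) (y : letter) : seq monomial :=
  if p is x :: p' then
    (letter_der x :: p', y) :: [seq (x :: m.1, m.2) | m <- monomial_der p' y]
  else [:: ([::], letter_der y)].

(** In a product only the last letter of the right factor stays last; that of the left factor joins
    the commuting letters. *)
Definition monomial_mul (m n : monomial) : monomial :=
  (m.1 ++ m.2 :: n.1, n.2).

Definition poly_scale (l : int) (P : dpoly) : dpoly :=
  [seq (l * t.1, t.2) | t <- P].

Definition poly_mul (P Q : dpoly) : dpoly :=
  [seq (t.1 * u.1, monomial_mul t.2 u.2) | t <- P, u <- Q].

Definition poly_der (P : dpoly) : dpoly :=
  flatten [seq [seq (t.1, m) | m <- monomial_der t.2.1 t.2.2] | t <- P].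

Fixpoint expand (e : dexpr) : dpoly :=
  match e with
  | DVar i => [:: (1, ([::], (i, 0%N)))]
  | DAdd e f => expand e ++ expand f
  | DOpp e => poly_scale (-1) (expand e)
  | DScale l e => poly_scale l (expand e)
  | DMul e f => poly_mul (expand e) (expand f)
  | DDer e => poly_der (expand e)
  end.

Definition same_monomial (m n : monomial) : bool :=
  (m.2 == n.2) && perm_eq m.1 n.1.

Fixpoint add_term (t : int * monomial) (P : dpoly) : dpoly :=
  if P is u :: P' then
    if same_monomial t.2 u.2 then (t.1 + u.1, u.2) :: P' else u :: add_term t P'
  else [:: t].

(** A cancelled monomial stays in the list with coefficient 0, so coefficients are tested rather
    than emptiness. *)
Definition poly_zero (P : dpoly) : bool :=
  all (fun t => t.1 == 0) (foldr add_term [::] P).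

(** * Soundness of the expansion in an arbitrary differential perm algebra *)

Section Evaluation.
Variables (k : fieldType) (A : diffPermAlgType k) (env : nat -> A).

Lemma pmul_sumr (I : Type) (r : seq I) (F : I -> A) (a : A) :
  pmul a (\sum_(i <- r) F i) = \sum_(i <- r) pmul a (F i).
Proof.
apply: (big_morph (pmul a)) => [b c|]; first exact: pmulDr.
(* Writing 0 as [0 *: 0] lets homogeneity give [pmul a 0 = 0]. *)
by rewrite -{1}(scale0r 0) pmulZr scale0r.
Qed.

Lemma pmul_suml (I : Type) (r : seq I) (F : I -> A) (a : A) :
  pmul (\sum_(i <- r) F i) a = \sum_(i <- r) pmul (F i) a.
Proof.
apply: (big_morph (fun b => pmul b a)) => [b c|]; first exact: pmulDl.
by rewrite -{1}(scale0r 0) pmulZl scale0r.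
Qed.

Lemma pder_sum (I : Type) (r : seq I) (F : I -> A) :
  pder (\sum_(i <- r) F i) = \sum_(i <- r) pder (F i).
Proof.
apply: (big_morph (@pder k A)) => [b c|]; first exact: pderD.
by rewrite -{1}(scale0r 0) pderZ scale0r.
Qed.

(** The perm identity as commutation of left multiplications; this is what allows the non-final
    letters to be reordered. *)
Lemma pmulCA (a b c : A) : pmul a (pmul b c) = pmul b (pmul a c).
Proof. by rewrite !pmulA pmul_perm. Qed.

Definition letter_val (x : letter) : A := iter x.2 pder (env x.1).

(** Nesting to the right onto [a] gives the empty word a value without a unit. *)
Definition word_val (p : seq letter) (a : A) : A :=
  foldr (fun x b => pmul (letter_val x) b) a p.

Definition monomial_val (m : monomial) : A := word_val m.1 (letter_val m.2).

Definition poly_val (P : dpoly) : A :=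
  \sum_(t <- P) t.1%:~R *: monomial_val t.2.

Fixpoint dexpr_val (e : dexpr) : A :=
  match e with
  | DVar i => env i
  | DAdd e f => dexpr_val e + dexpr_val f
  | DOpp e => - dexpr_val e
  | DScale l e => l%:~R *: dexpr_val e
  | DMul e f => pmul (dexpr_val e) (dexpr_val f)
  | DDer e => pder (dexpr_val e)
  end.

(** Induction on [p]: its head occurs in [q] and can be pulled to the front there by [pmulCA]. *)
Lemma word_val_perm p q a : perm_eq p q -> word_val p a = word_val q a.
Proof.
have word_val_cons x s t :
  word_val (s ++ x :: t) a = pmul (letter_val x) (word_val (s ++ t) a).
  by elim: s => //= y s ->; rewrite pmulCA.
elim: p q => [|x p IH] q pq; first by rewrite perm_sym in pq; rewrite (perm_nilP pq).
have /path.splitPr xq : x \in q by rewrite -(perm_mem pq) mem_head.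
(* Rotating [s ++ x :: t] exposes [x] for cancellation; rotating back leaves
   [perm_eq p (s ++ t)]. *)
case: xq pq => s t; rewrite perm_sym perm_catC /= perm_cons perm_catC perm_sym.
by move=> /IH /= ->; rewrite word_val_cons.
Qed.

Lemma monomial_val_same m n : same_monomial m n -> monomial_val m = monomial_val n.
Proof. by case/andP => /eqP e /word_val_perm; rewrite /monomial_val e => ->. Qed.

Lemma monomial_val_mul m n :
  monomial_val (monomial_mul m n) = pmul (monomial_val m) (monomial_val n).
Proof.
case: m => p x; rewrite /monomial_val /=.
by elim: p => //= y p ->; rewrite pmulA.
Qed.

Lemma monomial_val_der p y :
  pder (monomial_val (p, y)) = \sum_(m <- monomial_der p y) monomial_val m.
Proof.
elim: p => [|x p IH] /=; first by rewrite big_seq1.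
rewrite big_cons big_map [monomial_val _]/= pder_leibniz; congr (_ + _).
by rewrite [pder _]IH pmul_sumr.
Qed.

Lemma poly_val_scale l P : poly_val (poly_scale l P) = l%:~R *: poly_val P.
Proof.
rewrite /poly_val big_map scaler_sumr.
by apply: eq_bigr => t _; rewrite intrM scalerA.
Qed.

Lemma poly_val_mul P Q : poly_val (poly_mul P Q) = pmul (poly_val P) (poly_val Q).
Proof.
rewrite /poly_val big_allpairs_dep pmul_suml; apply: eq_bigr => t _.
rewrite pmul_sumr; apply: eq_bigr => u _.
by rewrite monomial_val_mul pmulZl pmulZr scalerA intrM.
Qed.

Lemma poly_val_der P : poly_val (poly_der P) = pder (poly_val P).
Proof.
rewrite /poly_val big_flatten big_map pder_sum; apply: eq_bigr => -[l [p y]] _.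
by rewrite big_map /= pderZ monomial_val_der scaler_sumr.
Qed.

Lemma poly_val_expand e : poly_val (expand e) = dexpr_val e.
Proof.
elim: e => [i|e IHe f IHf|e IHe|l e IHe|e IHe f IHf|e IHe] /=.
- by rewrite /poly_val big_seq1 scale1r.
- by rewrite -IHe -IHf /poly_val big_cat.
- by rewrite poly_val_scale IHe scaleN1r.
- by rewrite poly_val_scale IHe.
- by rewrite poly_val_mul IHe IHf.
- by rewrite poly_val_der IHe.
Qed.

Lemma poly_val_add_term t P :
  poly_val (add_term t P) = t.1%:~R *: monomial_val t.2 + poly_val P.
Proof.
rewrite /poly_val; elim: P => [|u P IH] /=; first by rewrite big_seq1 big_nil addr0.
case: ifP => [/monomial_val_same tu|_]; rewrite !big_cons /=.
  by rewrite tu intrD scalerDl addrA.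
by rewrite IH addrCA.
Qed.

(** Collecting equal monomials preserves the value, and afterwards every summand has coefficient
    0. *)
Lemma poly_zeroP P : poly_zero P -> poly_val P = 0.
Proof.
have -> : poly_val P = poly_val (foldr add_term [::] P).
  elim: P => //= t P IH.
  by rewrite poly_val_add_term -IH /poly_val big_cons.
move=> /allP P0; rewrite /poly_val big_seq big1 // => t /P0 /eqP ->.
by rewrite scale0r.
Qed.

(** Reflection principle: one boolean computation proves the identity for every choice of [env]. *)
Lemma dexpr_val_eq0 e : poly_zero (expand e) -> dexpr_val e = 0.
Proof. by rewrite -poly_val_expand; exact: poly_zeroP. Qed.

End Evaluation.

(** * The two identities as formal expressions *)

Definition DDia (e f : dexpr) : dexpr := DAdd (DMul e (DDer f)) (DMul f (DDer e)).
Definition DSub (e f : dexpr) : dexpr := DAdd e (DOpp f).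
Definition DAssoc (e f g : dexpr) : dexpr :=
  DSub (DDia (DDia e f) g) (DDia e (DDia f g)).

Definition tortken_expr : dexpr :=
  let a := DVar 0 in let b := DVar 1 in let c := DVar 2 in let d := DVar 3 in
  DSub (DAdd (DSub (DDia (DDia a b) (DDia c d)) (DDia (DDia a d) (DDia b c)))
             (DDia (DAssoc a b c) d))
       (DDia (DAssoc a d c) b).

(** Every term is a left-normed product with [a] in second place, hence the shorthand [w]. The left
    fold reproduces the bracketing of the sum in the theorem, so that evaluation matches it by
    conversion. *)
Definition degree5_expr : dexpr :=
  let a := DVar 0 in let b := DVar 1 in let c := DVar 2 in
  let d := DVar 3 in let e := DVar 4 in
  let w x y z t := DDia (DDia (DDia (DDia x a) y) z) t in
  foldl DAdd (DScale 2 (w b c d e))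
    [:: DOpp (w b c e d); DOpp (DScale 2 (w b d c e)); w b d e c;
        DOpp (w c b d e); w c b e d; w c d e b; DOpp (w c e b d);
        w d b c e; DOpp (w d b e c); DOpp (w d c e b); w d e b c;
        w e b c d; DOpp (w e b d c)].

Lemma tortken_expand : poly_zero (expand tortken_expr).
Proof. by vm_compute. Qed.

Lemma degree5_expand : poly_zero (expand degree5_expr).
Proof. by vm_compute. Qed.

Theorem proposition4p1 (k : fieldType) (hk : [pchar k] =i pred0) :
  [/\ forall a b : DerPerm k nat, a ⋄ b = b ⋄ a,
      forall a b c d : DerPerm k nat,
        (a ⋄ b) ⋄ (c ⋄ d) - (a ⋄ d) ⋄ (b ⋄ c) + ⟨a, b, c⟩ ⋄ d - ⟨a, d, c⟩ ⋄ b = 0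
    & forall a b c d e : DerPerm k nat,
          2%:R *: ((((b ⋄ a) ⋄ c) ⋄ d) ⋄ e) - ((((b ⋄ a) ⋄ c) ⋄ e) ⋄ d)
        - 2%:R *: ((((b ⋄ a) ⋄ d) ⋄ c) ⋄ e) + ((((b ⋄ a) ⋄ d) ⋄ e) ⋄ c)
        - ((((c ⋄ a) ⋄ b) ⋄ d) ⋄ e) + ((((c ⋄ a) ⋄ b) ⋄ e) ⋄ d)
        + ((((c ⋄ a) ⋄ d) ⋄ e) ⋄ b) - ((((c ⋄ a) ⋄ e) ⋄ b) ⋄ d)
        + ((((d ⋄ a) ⋄ b) ⋄ c) ⋄ e) - ((((d ⋄ a) ⋄ b) ⋄ e) ⋄ c)
        - ((((d ⋄ a) ⋄ c) ⋄ e) ⋄ b) + ((((d ⋄ a) ⋄ e) ⋄ b) ⋄ c)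
        + ((((e ⋄ a) ⋄ b) ⋄ c) ⋄ d) - ((((e ⋄ a) ⋄ b) ⋄ d) ⋄ c) = 0].
Proof.
split=> [a b|a b c d|a b c d e]; first exact: addrC.
(* The list assigns values to the variables by index; the default 0 is never read. *)
- exact: (dexpr_val_eq0 _ (DerPerm k nat) (nth 0 [:: a; b; c; d]) _ tortken_expand).
- exact: (dexpr_val_eq0 _ (DerPerm k nat) (nth 0 [:: a; b; c; d; e]) _ degree5_expand).
Qed.
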